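(* Let $S$ be any fixed finite semigroup. Then the space complexity of the out-of-order evaluation problem for $S$ is as follows: \begin{itemize} \item if $S\in\mathbf{Li}\lor\mathbf{Com}$, then it is $O(1)$; \item otherwise, it is in $\Omega(\log n)$. \end{itemize}
   Context: Problem. All semigroups are finite. Let $w=w[1]\cdots w[n]$ be a word of length $n>0$ over a fixed semigroup $S$ and let $\pi$ be a permutation of $\{1,\ldots,n\}$. The out-of-order stream of $w$ defined by $\pi$ is the sequence of triples $(w[\pi(i)],\pi(i),n)$ for $i=1,\ldots,n$. In the out-of-order evaluation problem for $S$, the algorithm receives the triples one after the other, for arbitrary $w$ and arbitrary $\pi$, and must output at the end the product $w[1]\cdot\cdots\cdot w[n]$ in $S$. The length $n$ is known and not counted in the space. Space. Algorithms are deterministic, and only the bits memorized between two consecutive stream elements are counted (computation time and interim memory used while processing an element are ignored). Formally, an algorithm using $s(n)$ bits consists, for each $n\ge 1$, of a set $Q_n$ of memory states with $|Q_n|\le 2^{s(n)}$, an initial state, an update function $Q_n\times S\times\{1,\ldots,n\}\to Q_n$, and an output function $Q_n\to S$, such that for every $w\in S^n$ and every permutation $\pi$ the output after processing the stream is the product of $w$. The problem has space complexity $O(g(n))$ if some algorithm uses $s(n)=O(g(n))$ bits; it has space complexity $\Omega(g(n))$ if every algorithm uses $s(n)=\Omega(g(n))$ bits, where $s=\Omega(g)$ means $\limsup_{n\to\infty}s(n)/g(n)>0$ (Hardy--Littlewood convention). Varieties. A variety of semigroups is a class of finite semigroups closed under direct products, sub-semigroups, and quotients by congruences. The join $\mathbf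 V\lor\mathbf W$ of two varieties is the smallest variety containing both. The idempotent power of a finite semigroup $S$ is the smallest positive integer $\omega$ such that $x^\omega=x^{2\omega}$ for all $x\in S$. $\mathbf{Com}$ is the variety of commutative semigroups. $\mathbf{Li}$ is the variety of semigroups $S$ satisfying $x^\omega yx^\omega=x^\omega$ for all $x,y\in S$ (equivalently, $x^\omega yz^\omega=x^\omega z^\omega$ for all $x,y,z\in S$). *)

(* Defs.v *)
From HB Require Import structures.
From mathcomp Require Import all_boot.

Set Implicit Arguments.
Unset Strict Implicit.
Unset Printing Implicit Defensive.

(* Semigroups are nonempty, as usual: over the empty semigroup there are no
   words of positive length, and no algorithm has an output function. *)
HB.mixin Record isInhabited (T : Type) := {
  inhabited_subproof : inhabited T
}.

#[short(type="finSemigroupType")]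
HB.structure Definition FinSemigroup :=
  {S of Semigroup S & Finite S & isInhabited S}.

(* The structure is declared before fingroup.v is loaded: Hierarchy-Builder
   rejects two unrelated structures that join Countable and Magma in the same
   context, and fingroup.v declares FinStarMonoid. *)
From mathcomp Require Import all_order all_algebra all_fingroup.
From mathcomp Require Import all_classical all_reals all_analysis.

Import Order.TTheory GRing.Theory Num.Theory.
Import numFieldNormedType.Exports.

Local Open Scope group_scope.

Lemma fin_semigroup_inhabited (S : finSemigroupType) : inhabited S.
Proof. exact: inhabited_subproof. Qed.

Section DirectProduct.
Variables S T : finSemigroupType.

Definition prod_mul (x y : S * T) : S * T := (x.1 * y.1, x.2 * y.2).

Lemma prod_mulA : associative prod_mul.
Proof. by move=> x y z; rewrite /prod_mul /= !mulgA. Qed.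

Lemma prod_inhabited : inhabited (S * T).
Proof.
by case: (fin_semigroup_inhabited S) (fin_semigroup_inhabited T) => x [y].
Qed.

HB.instance Definition _ := isSemigroup.Build (S * T)%type prod_mulA.
HB.instance Definition _ := isInhabited.Build (S * T)%type prod_inhabited.

End DirectProduct.

(* A class of finite semigroups is understood up to isomorphism. Hence the
   sub-semigroups of S are the T with an injective morphism T -> S, and the
   quotients of S by congruences are the T with a surjective morphism S -> T.
   The empty product needs no clause: the trivial semigroup is a quotient of
   every semigroup. *)
Definition is_variety (V : finSemigroupType -> Prop) : Prop :=
  [/\ forall S T : finSemigroupType, V S -> V T -> V (S * T)%type,
      forall (S T : finSemigroupType) (f : {multiplicative T -> S}),
        injective f -> V S -> V T
    & forall (S T : finSemigroupType) (f : {multiplicative S -> T}),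
        (forall y : T, exists x : S, f x = y) -> V S -> V T].

Definition variety_join (V W : finSemigroupType -> Prop) :
    finSemigroupType -> Prop :=
  fun S => forall U : finSemigroupType -> Prop, is_variety U ->
    (forall T, V T -> U T) -> (forall T, W T -> U T) -> U S.

(* x ^ n in a semigroup; meaningful for n > 0 only (the junk value at n = 0
   is x). *)
Definition spow (S : semigroupType) (x : S) (n : nat) : S :=
  iter n.-1 (fun y => x * y) x.

Definition idem_exponent (S : finSemigroupType) (n : nat) : bool :=
  (0 < n)%N && [forall x : S, spow x n == spow x (2 * n)].

Lemma spowD (S : semigroupType) (x : S) (m n : nat) :
  (0 < m)%N -> (0 < n)%N -> spow x (m + n) = spow x m * spow x n.
Proof.
case: m n => [|m] [|n] // _ _; elim: m => [|m IHm] //.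
by rewrite addSn addSn; move: IHm; rewrite addSn /spow /= => ->; rewrite mulgA.
Qed.

Lemma idem_exponent_exists (S : finSemigroupType) : exists n, idem_exponent S n.
Proof.
exists (#|S|)`!; rewrite /idem_exponent fact_gt0 /=; apply/forallP => x.
have S_gt0 : (0 < #|S|)%N by apply/card_gt0P; exists x.
have [i [j [lt_ij le_j eq_ij]]] : exists i j,
    [/\ (i < j)%N, (j <= #|S|)%N & spow x i.+1 = spow x j.+1].
  pose f (i : 'I_#|S|.+1) := spow x i.+1.
  have /injectivePn[a [b neq_ab eq_f]] : ~~ injectiveb f.
    apply/negP => /injectiveP /leq_card.
    by rewrite card_ord ltnn.
  have := neq_ab; rewrite -val_eqE neq_ltn => /orP[lt_ab|lt_ba].
    by exists (val a), (val b); split; rewrite // -ltnS ltn_ord.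
  by exists (val b), (val a); split; rewrite // -ltnS ltn_ord.
have per1 m : (i < m)%N -> spow x (m + (j - i)) = spow x m.
  have def_j : (i.+1 + (j - i))%N = j.+1 by rewrite addSn subnKC // ltnW.
  rewrite leq_eqVlt => /orP[/eqP <-|lt_im]; first by rewrite def_j eq_ij.
  rewrite -(subnK (ltnW lt_im)) -addnA def_j.
  by rewrite !spowD ?subn_gt0 // eq_ij.
have perk m k : (i < m)%N -> spow x (m + k * (j - i)) = spow x m.
  move=> lt_im; elim: k => [|k IHk]; first by rewrite mul0n addn0.
  by rewrite mulSn addnA addnAC per1 ?ltn_addr.
have /dvdnP[k def_k] : (j - i %| (#|S|)`!)%N.
  by rewrite dvdn_fact // subn_gt0 lt_ij (leq_trans (leq_subr _ _)).
rewrite mul2n -addnn {3}def_k perk //.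
apply: (leq_trans (leq_trans lt_ij le_j)).
by case: #|S| S_gt0 => // s _; rewrite factS leq_pmulr ?fact_gt0.
Qed.

Definition idempotent_power (S : finSemigroupType) : nat :=
  ex_minn (idem_exponent_exists S).

Definition Com (S : finSemigroupType) : Prop :=
  forall x y : S, x * y = y * x.

Definition Li (S : finSemigroupType) : Prop :=
  forall x y : S,
    spow x (idempotent_power S) * y * spow x (idempotent_power S) =
    spow x (idempotent_power S).

Definition word_product (S : semigroupType) (n : nat) (w : n.+1.-tuple S) : S :=
  foldl *%g (thead w) (behead w).

(* Positions are 0, ..., n-1. The third component n of the stream elements is
   constant, and is the parameter on which the whole algorithm depends. *)
Definition ooo_stream (S : Type) (n : nat) (w : n.-tuple S) (pi : 'S_n) :
    seq (S * 'I_n) :=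
  [seq (tnth w (pi i), pi i) | i <- enum 'I_n].

Record ooo_machine (S : Type) (n : nat) := OooMachine {
  memory : finType;
  initial : memory;
  update : memory -> S -> 'I_n -> memory;
  output : memory -> S
}.

Definition run (S : Type) (n : nat) (M : ooo_machine S n)
    (s : seq (S * 'I_n)) : memory M :=
  foldl (fun q e => update q e.1 e.2) (initial M) s.

(* Lengths n >= 1 are written n.+1. *)
Definition ooo_algorithm (S : Type) := forall n : nat, ooo_machine S n.+1.

Definition ooo_evaluates (S : finSemigroupType) (A : ooo_algorithm S) : Prop :=
  forall (n : nat) (w : n.+1.-tuple S) (pi : 'S_n.+1),
    output (run (A n) (ooo_stream w pi)) = word_product w.

Definition uses_bits (S : Type) (A : ooo_algorithm S) (s : nat -> nat) : Prop :=
  forall n : nat, (#|memory (A n)| <= 2 ^ s n.+1)%N.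

Local Open Scope classical_set_scope.
Local Open Scope ring_scope.

Definition ooo_space_bigO (R : realType) (S : finSemigroupType)
    (g : nat -> R) : Prop :=
  exists (A : ooo_algorithm S) (s : nat -> nat),
    [/\ ooo_evaluates A, uses_bits A s
      & (fun n => (s n)%:R : R) =O_\oo g].

(* Hardy-Littlewood convention: the upper limit is positive. It is taken in the
   extended reals, since the ratio may be unbounded. *)
Definition bigOmega (R : realType) (f g : nat -> R) : Prop :=
  (0 < limn_esup (fun n => (f n / g n)%:E))%E.

Definition ooo_space_bigOmega (R : realType) (S : finSemigroupType)
    (g : nat -> R) : Prop :=
  forall (A : ooo_algorithm S) (s : nat -> nat),
    ooo_evaluates A -> uses_bits A s -> bigOmega (fun n => (s n)%:R) g.

(* Main.v *)
(* Both cases are decided by the identity e y z f = e z y f for idempotents e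
   and f, which holds in Li and in Com and defines a variety.

   If it holds, letters in the middle of a long word can be permuted freely:
   by pigeonhole a long prefix absorbs an idempotent on its right and a long
   suffix absorbs one on its left. So the product of a word is determined by a
   prefix and a suffix of bounded length and by the numbers of occurrences of
   the letters, up to a threshold and modulo a period. These data fit in
   constant memory, and they are the image of the word in the product of two
   semigroups of Li and one of Com, of which S is then a divisor.

   If it fails, let the even positions carry e ... e y f ... f, with y at block
   i, and the odd ones e ... e z f ... f, with z at block j. For i and j
   multiples of 2 p, p an exponent making all powers idempotent, and g = e f,
   the product is e y z f, e y g^p z f or e z g^(2p-1) y f according to i = j,
   i < j or i > j. If these three were always equal then e y z f = e z y f would
   follow; hence for some y and z all the rows i are distinguished by columns j,
   and after the even positions linearly many memory states are needed. *)

From HB Require Import structures.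
Require Import Defs.
From mathcomp Require Import all_boot all_order all_algebra.
From mathcomp Require Import all_fingroup.
From mathcomp Require Import all_classical all_reals all_analysis.
From mathcomp Require Import zify.

Set Implicit Arguments.
Unset Strict Implicit.
Unset Printing Implicit Defensive.

Import Order.TTheory GRing.Theory Num.Theory.
Import numFieldNormedType.Exports.

Local Open Scope group_scope.

(** * Words: end windows and letter counts *)

Lemma seq_ends_inj (T : Type) k (u v : seq T) : size u = size v ->
  size u <= 2 * k -> take k u = take k v -> take k (rev u) = take k (rev v) ->
  u = v.
Proof.
move=> eq_sz le_k eq_pre; rewrite !take_rev -eq_sz => /(can_inj revK) eq_suf.
rewrite -(cat_take_drop k u) -(cat_take_drop k v) eq_pre; congr (_ ++ _).
have [le_u|lt_k] := leqP (size u) k; first by rewrite !drop_oversize -?eq_sz.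
have def_k : k = (k - (size u - k) + (size u - k))%N by lia.
by rewrite def_k -!drop_drop eq_suf.
Qed.

Lemma seq_middle (T : Type) k (u : seq T) : 2 * k <= size u ->
  exists m, u = take k u ++ m ++ rev (take k (rev u)).
Proof.
move=> le_k; exists (drop k (take (size u - k) u)).
rewrite take_rev revK -{1}(cat_take_drop (size u - k) u) catA; congr (_ ++ _).
by rewrite -{1}(cat_take_drop k (take _ u)) take_takel //; lia.
Qed.

Lemma size_take_leq (T : Type) k (s : seq T) : size (take k s) <= k.
Proof. by rewrite size_take; case: ltnP. Qed.

Lemma take_cat_takel (T : Type) n (s t : seq T) :
  take n (take n s ++ t) = take n (s ++ t).
Proof.
by elim: s n => [|a s IHs] [|n] //=; [rewrite take0|rewrite IHs].
Qed.

Lemma take_cat_taker (T : Type) n (s t : seq T) :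
  take n (s ++ take n t) = take n (s ++ t).
Proof.
elim: s n t => [|a s IHs] n t; first by rewrite /= take_takel.
by case: n => //= n; rewrite -(IHs n t) -(IHs n (take _ _)) take_takel.
Qed.

Lemma perm_filter_nseq (T : eqType) (a : T) w :
  perm_eq w (seq.filter (predC1 a) w ++ nseq (count_mem a w) a).
Proof.
have <- : seq.filter (pred1 a) w = nseq (count_mem a w) a.
  by rewrite -size_filter; apply/all_pred1P/filter_all.
by rewrite perm_sym perm_catC; apply/permPl/perm_filterC.
Qed.

Lemma eq_take_nth (T : Type) (x0 : T) k (u v : seq T) : size u = size v ->
  (forall j : 'I_k, nth x0 u j = nth x0 v j) -> take k u = take k v.
Proof.
move=> eq_sz eq_nth; apply: (@eq_from_nth _ x0) => [|i].
  by rewrite !size_take eq_sz.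
rewrite size_take => lt_i.
have lt_ik : i < k by move: lt_i; case: ifP; lia.
by rewrite !nth_take //; exact: (eq_nth (Ordinal lt_ik)).
Qed.

(** * Idempotents and powers *)

Section Powers.
Variable S : finSemigroupType.
Implicit Types (x e : S) (s : seq S).

Lemma foldl_mulg x a s : foldl *%g (x * a) s = x * foldl *%g a s.
Proof. by elim: s a => //= b s IHs a; rewrite -mulgA IHs. Qed.

Lemma foldl_rcons_mulg x s b : foldl *%g x (rcons s b) = x * foldr *%g b s.
Proof. by elim: s x => //= a s IHs x; rewrite IHs mulgA. Qed.

Lemma spowS x n : 0 < n -> spow x n.+1 = x * spow x n.
Proof. by case: n. Qed.

Lemma spowSr x n : 0 < n -> spow x n.+1 = spow x n * x.
Proof. by move=> n0; rewrite -addn1 spowD. Qed.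

Lemma spow_fix x g n : x * g = x -> x * spow g n = x.
Proof.
by move=> xg; rewrite /spow; elim: n.-1 => //= k IHk; rewrite mulgA xg.
Qed.

Lemma foldl_nseq x a n : 0 < n -> foldl *%g x (nseq n a) = x * spow a n.
Proof.
case: n => // n _; elim: n x => [|n IHn] x //.
rewrite -[foldl _ _ _]/(foldl *%g (x * a) (nseq n.+1 a)) IHn.
by rewrite [spow a n.+2]spowS // mulgA.
Qed.

Lemma idem_exponentP p :
  idem_exponent S p -> 0 < p /\ forall x, spow x p * spow x p = spow x p.
Proof.
case/andP=> p0 /forallP pP; split=> // x.
by rewrite -spowD // addnn -mul2n; apply/esym/eqP.
Qed.

Lemma spow_periodic p n k x : idem_exponent S p -> p <= n ->
  spow x (n + k * p) = spow x n.
Proof.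
move=> /idem_exponentP[p0 pP] le_pn.
elim: k => [|k IHk]; first by rewrite mul0n addn0.
rewrite mulSnr addnA (@spowD _ x (n + k * p)%N p) //; last first.
  by rewrite addn_gt0 (leq_trans p0).
rewrite IHk.
have [->|lt_pn] : n = p \/ p < n by lia.
  by rewrite pP.
by rewrite -(subnK le_pn) spowD ?subn_gt0 // -mulgA pP.
Qed.

Lemma idempotent_power_exponent : idem_exponent S (idempotent_power S).
Proof. by rewrite /idempotent_power; case: ex_minnP. Qed.

(** Pigeonhole on the prefix products: two coincide, so one is fixed by right multiplication by the
    factor in between, hence also by the idempotent power of that factor. *)
Lemma prefix_idempotent a s : #|S| <= size s ->
  exists s1 s2 e, [/\ s = s1 ++ s2, e * e = e &
    foldl *%g a s1 * e = foldl *%g a s1].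
Proof.
move=> le_S.
pose f (i : 'I_(size s).+1) := foldl *%g a (take i s).
have [i [j [lt_ij le_j eq_f]]] : exists i j : nat, [/\ i < j, j <= size s &
    foldl *%g a (take i s) = foldl *%g a (take j s)].
  have /injectivePn[i [j neq_ij eq_f]] : ~~ injectiveb f.
    by apply/negP => /injectiveP /leq_card; rewrite card_ord leqNgt ltnS le_S.
  move: neq_ij; rewrite -val_eqE neq_ltn => /orP[lt_ij|lt_ji].
    by exists i, j; split; rewrite // -ltnS.
  by exists j, i; split; rewrite // -ltnS.
have [p0 pP] := idem_exponentP idempotent_power_exponent.
move: eq_f; rewrite -(subnKC (ltnW lt_ij)) takeD foldl_cat.
case def_t: (take (j - i) (drop i s)) => [|b t] /=.
  have : size (take (j - i) (drop i s)) = 0 by rewrite def_t.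
  by rewrite size_takel ?size_drop; lia.
rewrite foldl_mulg => eq_f.
exists (take i s), (drop i s), (spow (foldl *%g b t) (idempotent_power S)).
by rewrite cat_take_drop pP; split => //; rewrite spow_fix.
Qed.

End Powers.

Section Converse.
Variable S : finSemigroupType.

(** The opposite semigroup, on the same carrier so that words over [S] can be read in it; it turns
    facts about prefixes into facts about suffixes. *)
Definition converse : Type := S.
HB.instance Definition _ := Finite.on converse.

Definition converse_mul (x y : converse) : converse := (y : S) * (x : S).

Lemma converse_mulA : associative converse_mul.
Proof. by move=> x y z; rewrite /converse_mul mulgA. Qed.

HB.instance Definition _ := isSemigroup.Build converse converse_mulA.
HB.instance Definition _ :=
  isInhabited.Build converse (fin_semigroup_inhabited S).

Lemma converse_mulE (x y : converse) : x * y = (y : S) * (x : S) :> S.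
Proof. by []. Qed.

Lemma foldl_converse (b : S) (s : seq S) :
  foldl *%g (b : converse) (rev s : seq converse) = foldr *%g b s.
Proof. by rewrite foldl_rev. Qed.

Lemma suffix_idempotent (b : S) (s : seq S) : #|S| <= size s ->
  exists s1 s2 e, [/\ s = s1 ++ s2, e * e = e &
    e * foldr *%g b s2 = foldr *%g b s2].
Proof.
rewrite -size_rev => le_S.
have [s1 [s2 [e [def_s ee es]]]] := @prefix_idempotent converse b (rev s) le_S.
exists (rev s2), (rev s1), e; split => //.
  by rewrite -rev_cat -def_s revK.
by rewrite -foldl_converse revK; exact: es.
Qed.

End Converse.

(** * The identity e y z f = e z y f *)

Definition middle_commutative (S : finSemigroupType) : Prop :=
  forall e f y z : S, e * e = e -> f * f = f -> e * y * z * f = e * z * y * f.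

Section MiddleCommutative.
Variables (S : finSemigroupType) (p : nat).
Hypotheses (mcS : middle_commutative S) (p_exp : idem_exponent S p).
Implicit Types (e f : S) (s u v w : seq S).

Lemma middle_swap e f y z t : e * e = e -> f * f = f ->
  e * y * z * t * f = e * z * y * t * f.
Proof.
move=> ee ff.
(* The inserted [e] is harmless: swap [a * e] with [b], absorb the [e] next to [f], swap back. With
   an [e] on both sides of [y * z], the identity applies with [f := e], whatever [t] follows. *)
have ins a b : e * a * b * f = e * a * e * b * f.
  have ef c : e * c * e * f = e * c * f by rewrite -mcS // ee.
  by rewrite -(mulgA e a e) [RHS]mcS // mulgA -(mulgA e b a) ef mulgA mcS.
by rewrite -(mulgA e y z) -(mulgA e z y) 2!ins 2!mulgA (mcS y z ee ee).
Qed.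

(** Exchanges of adjacent blocks generate all permutations, and each block acts as the single
    element that is its product. *)
Lemma foldl_perm e f v w : e * e = e -> f * f = f -> perm_eq v w ->
  foldl *%g e v * f = foldl *%g e w * f.
Proof.
move=> ee ff; apply: (catCA_perm_subst (F := fun s => foldl *%g e s * f)).
move=> [|a s1] [|b s2] // s3; rewrite ?cats0 //.
rewrite !foldl_cat /= !foldl_mulg.
case: s3 => [|c s3] /=; first exact: mcS.
by rewrite !foldl_mulg !mulgA middle_swap.
Qed.

Lemma foldl_pump e f a w k : e * e = e -> f * f = f -> p <= count_mem a w ->
  foldl *%g e (w ++ nseq (k * p) a) * f = foldl *%g e w * f.
Proof.
move=> ee ff le_p; have [p0 _] := idem_exponentP p_exp.
have w_perm := perm_filter_nseq a w.
rewrite [RHS](foldl_perm ee ff w_perm).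
have : perm_eq (w ++ nseq (k * p) a)
    ((seq.filter (predC1 a) w ++ nseq (count_mem a w) a) ++ nseq (k * p) a).
  by rewrite perm_cat2r.
move/(foldl_perm ee ff) => ->; congr (_ * _).
have c0 := leq_trans p0 le_p.
rewrite -catA -nseqD !foldl_cat !foldl_nseq ?addn_gt0 ?c0 //.
by rewrite spow_periodic.
Qed.

Lemma foldl_reduced_counts e f v w : e * e = e -> f * f = f ->
  (forall a, minn p (count_mem a v) = minn p (count_mem a w)) ->
  (forall a, count_mem a v = count_mem a w %[mod p]) ->
  foldl *%g e v * f = foldl *%g e w * f.
Proof.
move=> ee ff eq_min eq_mod.
(* Induction on a list [l] of letters whose counts may still differ; each step equalizes one count
   by pumping. *)
suff H (l : seq S) v' w' :
    (forall a, minn p (count_mem a v') = minn p (count_mem a w')) ->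
    (forall a, count_mem a v' = count_mem a w' %[mod p]) ->
    (forall a, a \notin l -> count_mem a v' = count_mem a w') ->
    foldl *%g e v' * f = foldl *%g e w' * f.
  by apply: (H (enum S)) => // a; rewrite mem_enum.
elim: l v' w' {v w eq_min eq_mod} => [|a l IHl] v w eq_min eq_mod eq_out.
  by apply: foldl_perm => //; apply/allP => a _; apply/eqP; exact: eq_out.
wlog le_vw : v w eq_min eq_mod eq_out / count_mem a v <= count_mem a w.
  move=> H; case: (leqP (count_mem a v) (count_mem a w)) => [|/ltnW] le_c.
    exact: H.
  by apply/esym/H => // b; last move=> /eq_out.
have [eq_a|neq_a] := eqVneq (count_mem a v) (count_mem a w).
  apply: IHl => // b b_l.
  have [->//|neq_b] := eqVneq b a.
  by apply: eq_out; rewrite inE negb_or neq_b.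
have le_p : p <= count_mem a v by move: (eq_min a); lia.
have /dvdnP[k def_k] : p %| count_mem a w - count_mem a v.
  by rewrite -eqn_mod_dvd //; apply/eqP.
rewrite -(foldl_pump k ee ff le_p).
have count_b b : b != a ->
    count_mem b (v ++ nseq (k * p) a) = count_mem b v.
  by move=> neq_b; rewrite count_cat count_nseq /= eq_sym (negPf neq_b) addn0.
have count_a : count_mem a (v ++ nseq (k * p) a) = count_mem a w.
  by rewrite count_cat count_nseq /= eqxx mul1n -def_k subnKC.
apply: IHl => b.
- by have [->|/count_b->] := eqVneq b a; rewrite ?count_a.
- by have [->|/count_b->] := eqVneq b a; rewrite ?count_a.
have [->|neq_b b_l] := eqVneq b a; first by rewrite count_a.
by rewrite count_b // eq_out // inE negb_or neq_b.
Qed.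

(** One starting letter, then [#|S|] letters for the pigeonhole that finds an idempotent. *)
Definition ends_length : nat := #|S|.+1.
(** The ends use up at most [2 * ends_length] occurrences of a letter; a threshold of [p] remains
    for the middle. *)
Definition count_threshold : nat := (2 * ends_length + p)%N.

(** A short word is recovered from its two ends. A long one is cut at an idempotent [e] absorbed by
    its prefix and an [f] absorbed by its suffix; between the cuts only reduced counts matter. *)
Lemma product_determined a s b t :
  take ends_length (a :: s) = take ends_length (b :: t) ->
  take ends_length (rev (a :: s)) = take ends_length (rev (b :: t)) ->
  (forall c, minn count_threshold (count_mem c (a :: s)) =
             minn count_threshold (count_mem c (b :: t))) ->
  (forall c, count_mem c (a :: s) = count_mem c (b :: t) %[mod p]) ->
  foldl *%g a s = foldl *%g b t.
Proof.
set u := a :: s; set v := b :: t => eq_pre eq_suf eq_min eq_mod.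
(* If one word is shorter than the threshold, its counts are exact, so the two words are
   permutations of each other. *)
have eq_size : size u < count_threshold \/ size v < count_threshold ->
    size u = size v.
  move=> lt_c; apply: perm_size; apply/allP => c _; apply/eqP.
  have minn_inj T m n x y : minn T m = minn T n -> m <= x -> n <= y ->
    x < T \/ y < T -> m = n by lia.
  exact: minn_inj (eq_min c) (count_size _ u) (count_size _ v) lt_c.
have [lt_u|le_u] := ltnP (size u) (2 * ends_length).
  have eq_sz : size u = size v by apply: eq_size; rewrite /count_threshold; lia.
  by have [-> ->] : u = v by apply: seq_ends_inj eq_pre eq_suf => //; lia.
have le_v : 2 * ends_length <= size v.
  rewrite leqNgt; apply/negP => lt_v.
  have : size u = size v by apply: eq_size; rewrite /count_threshold; lia.
  by lia.
have [m def_u] := seq_middle le_u; have [m' def_v] := seq_middle le_v.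
have [P def_P sz_P] : exists2 P, take ends_length u = a :: P & size P = #|S|.
  exists (take #|S| s) => //; rewrite size_takel //.
  by move: le_u; rewrite /u /ends_length /=; lia.
have [c [Q [def_Q sz_Q]]] : exists c Q,
    rev (take ends_length (rev u)) = rcons Q c /\ size Q = #|S|.
  have : size (rev (take ends_length (rev u))) = #|S|.+1.
    by rewrite size_rev size_takel // size_rev; lia.
  case/lastP: (rev _) => // Q c; rewrite size_rcons => -[szQ].
  by exists c, Q.
rewrite -eq_pre -eq_suf def_P def_Q /= in def_v.
rewrite def_P def_Q /= in def_u.
have [P1 [P2 [e [defP ee eP]]]] : exists s1 s2 e,
    [/\ P = s1 ++ s2, e * e = e & foldl *%g a s1 * e = foldl *%g a s1].
  by apply: prefix_idempotent; rewrite sz_P.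
have [Q1 [Q2 [f [defQ ff fQ]]]] : exists s1 s2 e,
    [/\ Q = s1 ++ s2, e * e = e & e * foldr *%g c s2 = foldr *%g c s2].
  by apply: suffix_idempotent; rewrite sz_Q.
have prodE x r n : x :: r = a :: (P ++ n ++ rcons Q c) ->
    foldl *%g x r = foldl *%g a P1 *
      (foldl *%g e (P2 ++ n ++ Q1) * f) * foldr *%g c Q2.
  case=> -> ->; rewrite defP defQ -catA foldl_cat -{1}eP foldl_mulg.
  have -> : P2 ++ n ++ rcons (Q1 ++ Q2) c = (P2 ++ n ++ Q1) ++ rcons Q2 c.
    by rewrite rcons_cat !catA.
  by rewrite foldl_cat foldl_rcons_mulg -{1}fQ !mulgA.
rewrite (prodE _ _ _ def_u) (prodE _ _ _ def_v); congr (_ * _ * _).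
have countE x r n d : x :: r = a :: (P ++ n ++ rcons Q c) ->
    count_mem d (x :: r) = (count_mem d (P2 ++ n ++ Q1) +
      (count_mem d (a :: P1) + count_mem d (rcons Q2 c)))%N.
  move=> ->; rewrite defP defQ /= -!cats1 !count_cat /=; lia.
have le_ends d :
    count_mem d (a :: P1) + count_mem d (rcons Q2 c) <= 2 * ends_length.
  have := count_size (pred1 d) (a :: P1).
  have := count_size (pred1 d) (rcons Q2 c).
  move: sz_P sz_Q; rewrite defP defQ !size_cat size_rcons /ends_length /=; lia.
apply: foldl_reduced_counts => // d.
  move: (eq_min d) (le_ends d).
  rewrite (countE _ _ _ d def_u) (countE _ _ _ d def_v).
  by rewrite /count_threshold; lia.
move: (eq_mod d); rewrite (countE _ _ _ d def_u) (countE _ _ _ d def_v).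
by move/eqP; rewrite eqn_modDr => /eqP.
Qed.

End MiddleCommutative.

Lemma is_variety_middle_commutative : is_variety middle_commutative.
Proof.
split=> [S T mcS mcT [e e'] [f f'] [y y'] [z z'] [ee ee'] [ff ff']
        |S T h h_inj mcS e f y z ee ff|S T h h_surj mcS e f y z ee ff].
- by congr (_, _); [exact: mcS|exact: mcT].
- by apply: h_inj; rewrite !gmulfM mcS // -gmulfM ?ee ?ff.
(* Idempotents lift along a surjection: the idempotent power of any preimage still maps to [x]. *)
have lift x : x * x = x -> exists2 x', x' * x' = x' & h x' = x.
  move=> xx; have [x' def_x] := h_surj x.
  have [p0 pP] := idem_exponentP (idempotent_power_exponent S).
  exists (spow x' (idempotent_power S)); first exact: pP.
  rewrite /spow; elim: _.-1 => //= n IHn.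
  by rewrite gmulfM IHn def_x.
have [[e' ee' <-] [f' ff' <-]] := (lift e ee, lift f ff).
have [[y' <-] [z' <-]] := (h_surj y, h_surj z).
by rewrite -!gmulfM mcS.
Qed.

Lemma spow_idempotent (S : finSemigroupType) (e : S) n :
  e * e = e -> spow e n = e.
Proof. by move=> ee; rewrite /spow; elim: n.-1 => //= k ->. Qed.

Lemma Li_idempotent (S : finSemigroupType) (e y : S) :
  Li S -> e * e = e -> e * y * e = e.
Proof. by move=> LiS ee; have := LiS e y; rewrite spow_idempotent. Qed.

Lemma Li_middle_commutative S : Li S -> middle_commutative S.
Proof.
move=> LiS.
(* Expand [e] into [e * f * e]; then [f * (e * y) * f] collapses to [f]. *)
have Li_rect (e f y : S) : e * e = e -> f * f = f -> e * y * f = e * f.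
  move=> ee ff; rewrite -[in LHS](Li_idempotent f LiS ee).
  by rewrite -!(mulgA e) -!(mulgA f) [f * _]mulgA Li_idempotent.
by move=> e f y z ee ff; rewrite -(mulgA e y) -(mulgA e z) !Li_rect.
Qed.

Lemma Com_middle_commutative S : Com S -> middle_commutative S.
Proof. by move=> ComS e f y z _ _; rewrite -(mulgA e y) (ComS y z) mulgA. Qed.

Lemma join_middle_commutative S :
  variety_join Li Com S -> middle_commutative S.
Proof.
apply; first exact: is_variety_middle_commutative.
  exact: Li_middle_commutative.
exact: Com_middle_commutative.
Qed.

(** * Division of a product of Li and Com semigroups *)

Record subsemigroup (T : finSemigroupType) := Subsemigroup {
  sub_pred : pred T;
  sub_mulg : forall x y, sub_pred x -> sub_pred y -> sub_pred (x * y);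
  sub_inhabited : exists x, sub_pred x
}.

Section Subsemigroup.
Variables (T : finSemigroupType) (D : subsemigroup T).

Definition sub_carrier : Type := {x : T | sub_pred D x}.
HB.instance Definition _ := Finite.on sub_carrier.

Definition sub_mul (x y : sub_carrier) : sub_carrier :=
  exist _ (val x * val y) (sub_mulg (valP x) (valP y)).

Lemma sub_mulA : associative sub_mul.
Proof. by move=> x y z; apply: val_inj; rewrite /= mulgA. Qed.

Lemma sub_carrier_inhabited : inhabited sub_carrier.
Proof. by have [x Dx] := sub_inhabited D; exists; exists x. Qed.

HB.instance Definition _ := isSemigroup.Build sub_carrier sub_mulA.
HB.instance Definition _ := isInhabited.Build sub_carrier sub_carrier_inhabited.

Definition sub_incl (x : sub_carrier) : T := val x.

Lemma sub_inclM : {morph sub_incl : x y / x * y >-> x * y}.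
Proof. by []. Qed.

HB.instance Definition _ :=
  isMultiplicative.Build sub_carrier T sub_incl sub_inclM.

End Subsemigroup.

(** [phi] need not be a morphism: as products of its values determine products in [S], the
    sub-semigroup generated by its image maps onto [S]. *)
Lemma variety_divisor (V : finSemigroupType -> Prop) (S T : finSemigroupType)
    (phi : S -> T) : is_variety V -> V T ->
  (forall a s b t,
    foldl *%g (phi a) (map phi s) = foldl *%g (phi b) (map phi t) ->
    foldl *%g a s = foldl *%g b t) ->
  V S.
Proof.
move=> [_ V_sub V_quo] VT phi_det.
pose P (x : T) := `[< exists w, x = foldl *%g (phi w.1) (map phi w.2) >].
have PM x y : P x -> P y -> P (x * y).
  move=> /asboolP[[a s] /= ->] /asboolP[[b t] /= ->]; apply/asboolP.
  by exists (a, s ++ b :: t); rewrite /= map_cat foldl_cat /= foldl_mulg.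
have [a0] := fin_semigroup_inhabited S.
have P_inh : exists x, P x.
  by exists (phi a0); apply/asboolP; exists (a0, [::]).
pose D := Subsemigroup PM P_inh.
have VD : V (sub_carrier D).
  exact: (V_sub T (sub_carrier D) (@sub_incl T D) val_inj VT).
have wP (x : sub_carrier D) :
    exists w, val x = foldl *%g (phi w.1) (map phi w.2).
  exact/asboolP/(valP x).
(* [h] picks some word whose image has product [x]; by [phi_det] the value does not depend on the
   choice. *)
pose h x := let w := projT1 (cid (wP x)) in foldl *%g w.1 w.2.
have hE x a s : val x = foldl *%g (phi a) (map phi s) -> h x = foldl *%g a s.
  by rewrite /h; case: cid => w /= ->; exact: phi_det.
have hM : {morph h : x y / x * y >-> x * y}.
  move=> x y; have [[[a s] /= xE] [[b t] /= yE]] := (wP x, wP y).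
  rewrite (hE _ _ _ xE) (hE _ _ _ yE) (hE _ a (s ++ b :: t)).
    by rewrite foldl_cat /= foldl_mulg.
  apply: (etrans (congr2 *%g xE yE)).
  by rewrite map_cat foldl_cat /= foldl_mulg.
pose hh : {multiplicative sub_carrier D -> S} :=
  HB.pack h (isMultiplicative.Build (sub_carrier D) S h hM).
apply: (V_quo _ _ hh) VD => y.
have Py : P (phi y) by apply/asboolP; exists (y, [::]).
by exists (exist _ (phi y) Py); exact: (hE _ y [::]).
Qed.

Section PrefixWords.
Variables (S : finSemigroupType) (k : nat).

(* Nonempty words over S truncated to length k + 1: a first letter and at most
   k further ones. *)
Definition prefix_word : Type := (S * k.-bseq S)%type.
HB.instance Definition _ := Finite.on prefix_word.

Implicit Types x y : prefix_word.

Definition prefix_letters x : seq S := x.1 :: x.2.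

Definition prefix_mul x y : prefix_word :=
  (x.1, Bseq (size_take_leq k (x.2 ++ prefix_letters y))).

Definition prefix_letter (a : S) : prefix_word := (a, [bseq]).

Lemma prefix_letters_inj : injective prefix_letters.
Proof. by move=> [a s] [b t] [/= -> /val_inj ->]. Qed.

Lemma prefix_letters_mul x y : prefix_letters (prefix_mul x y) =
  take k.+1 (prefix_letters x ++ prefix_letters y).
Proof. by []. Qed.

Lemma prefix_mulA : associative prefix_mul.
Proof.
move=> x y z; apply: prefix_letters_inj.
rewrite !prefix_letters_mul take_cat_takel take_cat_taker.
by rewrite catA.
Qed.

Lemma prefix_word_inhabited : inhabited prefix_word.
Proof.
by have [a] := fin_semigroup_inhabited S; exists; exact: prefix_letter.
Qed.

HB.instance Definition _ := isSemigroup.Build prefix_word prefix_mulA.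
HB.instance Definition _ := isInhabited.Build prefix_word prefix_word_inhabited.

(** Squaring lengthens a word that is not yet full, so an idempotent is full and truncation discards
    whatever follows it. *)
Lemma prefix_idempotent_left_zero x y : x * x = x -> x * y = x.
Proof.
move=> xx; have sz_x : k <= size x.2.
  rewrite leqNgt; apply/negP => lt_k.
  have := congr1 (fun z : prefix_word => size z.2) xx.
  by rewrite /= size_take size_cat /=; case: ifP; lia.
apply: prefix_letters_inj; rewrite [LHS]prefix_letters_mul.
rewrite take_cat /=; case: ifP => [|_]; first by rewrite ltnNge ltnS size_bseq.
have -> : (k.+1 - (size x.2).+1 = 0)%N by lia.
by rewrite take0 cats0.
Qed.

Lemma Li_prefix_word : Li prefix_word.
Proof.
move=> x y.
have [_ pP] := idem_exponentP (idempotent_power_exponent prefix_word).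
move: (spow x _) (pP x) => e ee.
by rewrite (prefix_idempotent_left_zero y ee).
Qed.

Lemma foldl_prefix_letter a s :
  prefix_letters (foldl *%g (prefix_letter a) (map prefix_letter s)) =
  take k.+1 (a :: s).
Proof.
rewrite -[a :: s]/(prefix_letters (prefix_letter a) ++ s).
elim: s (prefix_letter a) => [|b s IHs] x /=.
  by rewrite cats0 take_oversize // size_bseq.
rewrite IHs [prefix_letters _]prefix_letters_mul take_cat_takel.
by rewrite -catA.
Qed.

Lemma foldr_prefix_letter a s :
  prefix_letters (foldr *%g (prefix_letter a) (map prefix_letter s)) =
  take k.+1 (rcons s a).
Proof.
elim: s => [|b s IHs] //=.
by rewrite [prefix_letters _]prefix_letters_mul IHs take_cat_taker.
Qed.

End PrefixWords.

Lemma Li_converse (S : finSemigroupType) : Li S -> Li (converse S).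
Proof.
move=> LiS x y.
have [_ pP] := idem_exponentP (idempotent_power_exponent (converse S)).
move: (spow x _) (pP x) => e ee.
by rewrite converse_mulE mulgA; exact: (@Li_idempotent S).
Qed.

(** * Commutative images: letter counts with threshold and period *)

Section Parikh.
Variables (A : finType) (t q : nat).

(* Letter counts up to the threshold t, and modulo q + 1. *)
Definition parikh_vector : Type := {ffun A -> 'I_t.+1 * 'I_q.+1}.
HB.instance Definition _ := Finite.on parikh_vector.

Definition reduce_count (n : nat) : 'I_t.+1 * 'I_q.+1 :=
  (inord (minn t n), inord (n %% q.+1)).

Definition parikh_mul (x y : parikh_vector) : parikh_vector :=
  [ffun a => (inord (minn t ((x a).1 + (y a).1)),
              inord (((x a).2 + (y a).2) %% q.+1))].

Lemma leq_modS n : n %% q.+1 <= q.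
Proof. by rewrite -ltnS ltn_pmod. Qed.

Lemma reduce_count_inj m n : reduce_count m = reduce_count n ->
  minn t m = minn t n /\ m = n %[mod q.+1].
Proof.
case=> /(congr1 val) + /(congr1 val).
by rewrite /= !inordK ?ltnS ?geq_minl ?leq_modS.
Qed.

Lemma parikh_mulA : associative parikh_mul.
Proof.
move=> x y z; apply/ffunP => a; rewrite !ffunE; congr (_, _); apply: val_inj;
  rewrite /= !inordK ?ltnS ?geq_minl ?leq_modS //.
  lia.
by rewrite modnDml modnDmr addnA.
Qed.

Lemma parikh_inhabited : inhabited parikh_vector.
Proof. by exists; exact: [ffun=> (ord0, ord0)]. Qed.

HB.instance Definition _ := isSemigroup.Build parikh_vector parikh_mulA.
HB.instance Definition _ := isInhabited.Build parikh_vector parikh_inhabited.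

Lemma Com_parikh_vector : Com parikh_vector.
Proof.
by move=> x y; apply/ffunP => a; rewrite !ffunE; congr (inord _, inord _);
  rewrite addnC.
Qed.

Definition parikh (s : seq A) : parikh_vector :=
  [ffun a => reduce_count (count_mem a s)].

Lemma parikh_cat s u : parikh (s ++ u) = parikh s * parikh u.
Proof.
apply/ffunP => a; rewrite !ffunE count_cat; congr (_, _); apply: val_inj;
  rewrite /= !inordK ?ltnS ?geq_minl ?leq_modS //.
  lia.
by rewrite modnDm.
Qed.

Lemma foldl_parikh a s :
  foldl *%g (parikh [:: a]) [seq parikh [:: b] | b <- s] = parikh (a :: s).
Proof.
rewrite -[a :: s]/([:: a] ++ s); elim: s [:: a] => [|b s IHs] r /=.
  by rewrite cats0.
by rewrite -parikh_cat IHs -catA.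
Qed.

End Parikh.

Lemma foldl_morph (S T : semigroupType) (h : S -> T) a s :
  {morph h : x y / x * y >-> x * y} ->
  h (foldl *%g a s) = foldl *%g (h a) (map h s).
Proof. by move=> hM; elim: s a => //= b s IHs a; rewrite IHs hM. Qed.

Lemma middle_commutative_join S :
  middle_commutative S -> variety_join Li Com S.
Proof.
move=> mcS V V_var LiV ComV; have p_exp := idempotent_power_exponent S.
have [p0 _] := idem_exponentP p_exp.
set p := idempotent_power S in p_exp p0.
(* Words in [L] keep [#|S| + 1] letters, which is [ends_length S]; in [C], the parameter [p.-1]
   stands for the modulus [p]. *)
pose L : finSemigroupType := prefix_word S #|S|.
pose C : finSemigroupType := parikh_vector S (count_threshold S p) p.-1.
pose phi (a : S) : (L * converse L) * C :=
  (prefix_letter _ a, prefix_letter _ a : converse L, parikh _ _ [:: a]).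
apply: (@variety_divisor V S ((L * converse L) * C)%type phi) => //.
  case: (V_var) => V_prod _ _.
  apply: (V_prod); last exact/ComV/Com_parikh_vector.
  by apply: (V_prod); apply: LiV; [|apply: Li_converse]; apply: Li_prefix_word.
move=> a s b t eq_phi; apply: (product_determined mcS p_exp).
- have /(congr1 (@prefix_letters _ _)) := congr1 (fun x => x.1.1) eq_phi.
  by rewrite !(@foldl_morph _ _ (fun x : (L * converse L) * C => x.1.1)) //
    -!map_comp !foldl_prefix_letter.
- have /(congr1 (@prefix_letters S #|S|)) := congr1 (fun x => x.1.2) eq_phi.
  rewrite !(@foldl_morph _ _ (fun x : (L * converse L) * C => x.1.2)) //.
  (* A product in [converse L] is the product in [L] of the reversed word, whose prefix records the
     last letters. *)
  rewrite -!map_comp -[map _ s]revK -[map _ t]revK !foldl_converse -!map_rev.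
  by rewrite !foldr_prefix_letter -!rev_cons.
all: have := congr1 (fun x => x.2) eq_phi.
all: rewrite !(@foldl_morph _ _ (fun x : (L * converse L) * C => x.2)) //.
all: rewrite -!map_comp !foldl_parikh => /ffunP eq_c c.
all: have := eq_c c; rewrite !ffunE => /reduce_count_inj[].
  by [].
by rewrite prednK.
Qed.

(** * Constant memory *)

Lemma tuple_headE (S : semigroupType) n (w : n.+1.-tuple S) :
  tval w = thead w :: behead w.
Proof. by case/tupleP: w => a w; rewrite theadE. Qed.

Lemma ooo_streamE (S : Type) n (w : n.-tuple S) (pi : 'S_n) :
  ooo_stream w pi = [seq (tnth w i, i) | i <- [seq pi i | i <- enum 'I_n]].
Proof. by rewrite -map_comp. Qed.

Section WindowMachine.
Variables (S : finSemigroupType) (x0 : S) (k t q n : nat).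

(** Letters by distance from the left end, letters by distance from the right end, and reduced
    counts. Slots unfilled or beyond a short word hold [x0], the default of [nth] in [summary]. *)
Definition window_memory : Type :=
  ({ffun 'I_k -> S} * {ffun 'I_k -> S} * parikh_vector S t q)%type.
HB.instance Definition _ := Finite.on window_memory.

Definition window_update (m : window_memory) (a : S) (i : 'I_n.+1) :
    window_memory :=
  ([ffun j : 'I_k => if j == i :> nat then a else m.1.1 j],
   [ffun j : 'I_k => if (j + i)%N == n then a else m.1.2 j],
   m.2 * parikh t q [:: a]).

Definition window_initial : window_memory :=
  ([ffun=> x0], [ffun=> x0], parikh t q [::]).

Definition summary (w : seq S) : window_memory :=
  ([ffun j : 'I_k => nth x0 w j], [ffun j : 'I_k => nth x0 (rev w) j],
   parikh t q w).

(** Any word with this summary will do when the summary determines the product; after a full stream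
    the search cannot fail. *)
Definition window_output (m : window_memory) : S :=
  if [pick w : n.+1.-tuple S | summary w == m] is Some w then word_product w
  else x0.

Definition window_machine : ooo_machine S n.+1 :=
  OooMachine window_initial window_update window_output.

Lemma run_window_partial (w : n.+1.-tuple S) (l : seq 'I_n.+1) :
  run window_machine [seq (tnth w i, i) | i <- l] =
  ([ffun j : 'I_k => if has (fun i : 'I_n.+1 => j == i :> nat) l
                     then nth x0 w j else x0],
   [ffun j : 'I_k => if has (fun i : 'I_n.+1 => (j + i)%N == n) l
                     then nth x0 (rev w) j else x0],
   parikh t q [seq tnth w i | i <- l]).
Proof.
rewrite /run; elim/last_ind: l => [|l i IHl].
  by congr (_, _, _); apply/ffunP => j; rewrite !ffunE.
rewrite map_rcons foldl_rcons IHl /= /window_update /=; congr (_, _, _).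
- apply/ffunP => j; rewrite !ffunE has_rcons.
  by case: eqP => //= ->; rewrite (tnth_nth x0).
- apply/ffunP => j; rewrite !ffunE has_rcons.
  case: eqP => //= def_n; rewrite nth_rev size_tuple; last by lia.
  by rewrite (tnth_nth x0); congr (nth _ _ _); lia.
by rewrite -parikh_cat map_rcons cats1.
Qed.

Lemma run_window (w : n.+1.-tuple S) (pi : 'S_n.+1) :
  run window_machine (ooo_stream w pi) = summary w.
Proof.
rewrite ooo_streamE; set l := map _ (enum _).
have mem_l i : i \in l.
  by apply/mapP; exists (pi^-1 i)%g; rewrite ?mem_enum ?permKV.
have perm_l : perm_eq l (enum 'I_n.+1).
  apply: uniq_perm; rewrite ?enum_uniq //.
    by rewrite (map_inj_uniq perm_inj) enum_uniq.
  by move=> i; rewrite mem_l mem_enum.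
rewrite run_window_partial; congr (_, _, _).
- apply/ffunP => j; rewrite !ffunE; case: ifP => // /negbT/hasPn no_j.
  rewrite nth_default // size_tuple leqNgt; apply/negP => lt_j.
  by have := no_j (Ordinal lt_j) (mem_l _); rewrite eqxx.
- apply/ffunP => j; rewrite !ffunE; case: ifP => // /negbT/hasPn no_j.
  rewrite nth_default // size_rev size_tuple leqNgt; apply/negP => lt_j.
  have lt_nj : n - j < n.+1 by lia.
  have := no_j (Ordinal lt_nj) (mem_l _); rewrite /=; lia.
apply/ffunP => a; rewrite !ffunE; congr reduce_count.
rewrite -[in RHS](map_tnth_enum w).
by have /seq.permP-> := perm_map (tnth w) perm_l.
Qed.

End WindowMachine.

Lemma middle_commutative_constant_space (R : realType) (S : finSemigroupType) :
  middle_commutative S -> ooo_space_bigO S (fun=> 1%R : R).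
Proof.
move=> mcS; have p_exp := idempotent_power_exponent S.
have [p0 _] := idem_exponentP p_exp.
move: (idempotent_power S) p_exp p0 => p p_exp p0.
have [x0] := fin_semigroup_inhabited S.
pose k := ends_length S; pose t := count_threshold S p.
pose c := #|{: window_memory S k t p.-1}|.
have det n (u w : n.+1.-tuple S) :
    summary x0 k t p.-1 u = summary x0 k t p.-1 w ->
    word_product u = word_product w.
  move=> eq_uw; rewrite /word_product; apply: (product_determined mcS p_exp);
    rewrite -!tuple_headE.
  - apply: (@eq_take_nth _ x0) => [|j]; first by rewrite !size_tuple.
    by have /ffunP/(_ j) := congr1 (fun m => m.1.1) eq_uw; rewrite !ffunE.
  - apply: (@eq_take_nth _ x0) => [|j]; first by rewrite !size_rev !size_tuple.
    by have /ffunP/(_ j) := congr1 (fun m => m.1.2) eq_uw; rewrite !ffunE.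
  - move=> a; have /ffunP/(_ a) := congr1 (fun m => m.2) eq_uw.
    by rewrite !ffunE => /reduce_count_inj[].
  move=> a; have /ffunP/(_ a) := congr1 (fun m => m.2) eq_uw.
  by rewrite !ffunE => /reduce_count_inj[_]; rewrite prednK.
exists (fun n => window_machine x0 k t p.-1 n), (fun=> c); split.
- move=> n w pi; rewrite run_window /= /window_output.
  by case: pickP => [u /eqP /det //|/(_ w)]; rewrite eqxx.
(* The number [c] of states does not depend on [n]; the crude [c <= 2 ^ c] allows [c] bits. *)
- by move=> n; apply: ltnW; rewrite /= -/c ltn_expl.
apply/eqO_exP; exists (c%:R + 1)%R; first by rewrite ltr_wpDl.
by near=> n; rewrite normr1 mulr1 normr_nat lerDl.
Unshelve. all: by end_near.
Qed.

(** * Logarithmic lower bound *)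

Lemma seq_perm_exists n (l : seq 'I_n) : uniq l -> size l = n ->
  exists pi : 'S_n, [seq pi i | i <- enum 'I_n] = l.
Proof.
move=> l_uniq /eqP sz_l; pose lt := Tuple sz_l.
have lt_inj : injective (tnth lt) by apply/tuple_uniqP.
exists (perm lt_inj); rewrite -[RHS](map_tnth_enum lt).
by apply: eq_map => i; rewrite permE.
Qed.

Definition mix (S : Type) n (P : pred 'I_n) (r c : 'I_n -> S) : n.-tuple S :=
  [tuple if P k then r k else c k | k < n].

(* The states reached after the positions in P have been read must be pairwise
   distinct: two equal ones could not be told apart by any completion. *)
Lemma fooling_set (S : Type) n (M : ooo_machine S n) (ans : n.-tuple S -> S)
    (P : pred 'I_n) m (r c : 'I_m -> 'I_n -> S) :
  (forall w pi, output (run M (ooo_stream w pi)) = ans w) ->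
  (forall i j : 'I_m, i < j ->
     exists l, ans (mix P (r i) (c l)) <> ans (mix P (r j) (c l))) ->
  m <= #|memory M|.
Proof.
move=> M_ans r_sep.
(* The stream presents the positions in [P] first, so [state i] is reached before any letter of a
   column is read. *)
pose l1 := seq.filter P (enum 'I_n).
pose l2 := seq.filter (predC P) (enum 'I_n).
have l_perm : perm_eq (l1 ++ l2) (enum 'I_n) by apply/permPl/perm_filterC.
have [pi def_pi] : exists pi : 'S_n, [seq pi i | i <- enum 'I_n] = l1 ++ l2.
  apply: seq_perm_exists; first by rewrite (perm_uniq l_perm) enum_uniq.
  by rewrite (perm_size l_perm) size_enum_ord.
pose state i := run M [seq (r i k, k) | k <- l1].
have ansE i l : ans (mix P (r i) (c l)) =
    output (foldl (fun s x => update s x.1 x.2) (state i)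
             [seq (c l k, k) | k <- l2]).
  rewrite -(M_ans _ pi) ooo_streamE def_pi map_cat /run foldl_cat.
  congr (output (foldl _ (foldl _ _ _) _)); apply/eq_in_map => k;
    rewrite mem_filter tnth_mktuple => /andP[].
    by move=> ->.
  by move=> /negPf ->.
suff state_inj : injective state.
  by rewrite -[m]card_ord; exact: leq_card state_inj.
move=> i j eq_ij; apply: val_inj; case: (ltngtP i j) => // lt_ij.
  by have [l []] := r_sep i j lt_ij; rewrite !ansE eq_ij.
by have [l []] := r_sep j i lt_ij; rewrite !ansE eq_ij.
Qed.

(** * Marker words and their products *)

Section Interleaving.
Variable S : finSemigroupType.
Implicit Types (x e f y z g : S) (G r c : nat -> S).

(** An idempotent first letter may be supplied once more as the initial value of the fold. *)
Lemma word_product_mkseq n (w : n.+1.-tuple S) G :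
  tval w = mkseq G n.+1 -> G 0 * G 0 = G 0 ->
  word_product w = foldl *%g (G 0) (mkseq G n.+1).
Proof.
move=> def_w GG; rewrite -def_w [tval w]tuple_headE /word_product /=.
have -> : thead w = G 0; last by rewrite GG.
by have := tuple_headE w; rewrite def_w => -[].
Qed.

Definition interleave r c k : S := if odd k then c k./2 else r k./2.

Lemma foldl_interleave x r c n :
  foldl *%g x (mkseq (interleave r c) n.*2) =
  foldl *%g x (mkseq (fun b => r b * c b) n).
Proof.
elim: n => // n IHn; rewrite doubleS !mkseqS !foldl_rcons IHn.
by rewrite /interleave /= odd_double /= uphalf_double doubleK mulgA.
Qed.

Lemma map_iota_const G g a n : (forall b, a <= b < a + n -> G b = g) ->
  map G (iota a n) = nseq n g.
Proof.
elim: n a => //= n IHn a Gg; rewrite Gg; last by lia.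
by rewrite IHn // => b lt_b; rewrite Gg //; lia.
Qed.

Lemma foldl_nseq_idempotent e n : e * e = e -> foldl *%g e (nseq n e) = e.
Proof. by move=> ee; elim: n => //= n; rewrite ee. Qed.

(** The strict bounds leave at least one [g] and one [f], so no power with exponent 0 occurs. *)
Lemma foldl_steps G e f g a b I J N : e * e = e -> f * f = f ->
  I.+1 < J -> J.+1 < N ->
  (forall n, n < I -> G n = e) -> G I = a -> (forall n, I < n < J -> G n = g) ->
  G J = b -> (forall n, J < n < N -> G n = f) ->
  foldl *%g e (mkseq G N) = e * a * spow g (J - I.+1) * b * f.
Proof.
move=> ee ff lt_IJ lt_JN Ge Ga Gg Gb Gf; rewrite /mkseq.
have -> : N = (I + (1 + ((J - I.+1) + (1 + (N - J.+1)))))%N by lia.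
rewrite !iotaD !map_cat !foldl_cat /=.
rewrite (@map_iota_const _ e); last by move=> n lt_n; apply: Ge; lia.
rewrite foldl_nseq_idempotent // add0n Ga.
rewrite (@map_iota_const _ g); last by move=> n lt_n; apply: Gg; lia.
have -> : (I + 1 + (J - I.+1))%N = J by lia.
rewrite Gb (@map_iota_const _ f); last by move=> n lt_n; apply: Gf; lia.
by rewrite !foldl_nseq ?subn_gt0 // (spow_idempotent _ ff).
Qed.

Lemma foldl_step G e f a I N : e * e = e -> f * f = f -> I.+1 < N ->
  (forall n, n < I -> G n = e) -> G I = a ->
  (forall n, I < n < N -> G n = f) ->
  foldl *%g e (mkseq G N) = e * a * f.
Proof.
move=> ee ff lt_IN Ge Ga Gf; rewrite /mkseq.
have -> : N = (I + (1 + (N - I.+1)))%N by lia.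
rewrite !iotaD !map_cat !foldl_cat /=.
rewrite (@map_iota_const _ e); last by move=> n lt_n; apply: Ge; lia.
rewrite foldl_nseq_idempotent // add0n Ga.
rewrite (@map_iota_const _ f); last by move=> n lt_n; apply: Gf; lia.
by rewrite foldl_nseq ?subn_gt0 // (spow_idempotent _ ff).
Qed.

Lemma spow_conj x y n : 0 < n -> x * spow (y * x) n * y = spow (x * y) n.+1.
Proof.
case: n => // n _; elim: n => [|n IHn]; first by rewrite /spow /= !mulgA.
by rewrite (spowS (y * x)) // (spowS (x * y)) // -IHn !mulgA.
Qed.

Definition marker e f y I b : S :=
  if b < I then e else if b == I then y else f.

Lemma marker_lt e f y I b : b < I -> marker e f y I b = e.
Proof. by rewrite /marker => ->. Qed.

Lemma marker_eq e f y I : marker e f y I I = y.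
Proof. by rewrite /marker ltnn eqxx. Qed.

Lemma marker_gt e f y I b : I < b -> marker e f y I b = f.
Proof. by rewrite /marker; case: ltngtP. Qed.

Section Markers.
Variables (p : nat) (e f y z : S).
Hypotheses (p_exp : idem_exponent S p) (ee : e * e = e) (ff : f * f = f).

Let g := e * f.
Let G I J b := marker e f y I b * marker e f z J b.

Lemma markers_diag I N : I.+1 < N ->
  foldl *%g e (mkseq (G I I) N) = e * y * z * f.
Proof.
move=> lt_I; rewrite (@foldl_step _ e f (y * z) I) ?mulgA // /G.
- by move=> n lt_n; rewrite !marker_lt.
- by rewrite !marker_eq.
by move=> n /andP[lt_n _]; rewrite !marker_gt.
Qed.

Lemma markers_upper i j N : i < j -> (j * (2 * p)).+1 < N ->
  foldl *%g e (mkseq (G (i * (2 * p)) (j * (2 * p))) N) =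
  e * y * spow g p * z * f.
Proof.
have [p0 _] := idem_exponentP p_exp; move=> lt_ij lt_N.
set I := (i * _)%N; set J := (j * _)%N in lt_N *.
have [d def_d] : exists d, j = (i + d.+1)%N by exists (j - i.+1); lia.
have def_J : J = (I + d.+1 * (2 * p))%N by rewrite /J def_d mulnDl.
rewrite (@foldl_steps _ e f (f * e) (y * e) (f * z) I J) //; try lia.
(* Regrouping turns [e (f e)^n f] into [(e f)^(n+1)], where [n + 1 = J - I] is a positive multiple
   of [p]. *)
- have gap : (J - I.+1).+1 = (p + (d.*2.+1) * p)%N by rewrite def_J; lia.
  rewrite -(spow_periodic d.*2.+1 g p_exp (leqnn p)) -gap.
  rewrite -spow_conj; last by lia.
  by rewrite !mulgA.
- by move=> n lt_n; rewrite /G !marker_lt //; lia.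
- by rewrite /G marker_eq marker_lt //; lia.
- by move=> n /andP[lt_n lt_nJ]; rewrite /G marker_gt // marker_lt.
- by rewrite /G marker_eq marker_gt //; lia.
by move=> n /andP[lt_n lt_nN]; rewrite /G !marker_gt //; lia.
Qed.

Lemma markers_lower i j N : j < i -> (i * (2 * p)).+1 < N ->
  foldl *%g e (mkseq (G (i * (2 * p)) (j * (2 * p))) N) =
  e * z * spow g (2 * p).-1 * y * f.
Proof.
have [p0 _] := idem_exponentP p_exp; move=> lt_ji lt_N.
set I := (i * _)%N in lt_N *; set J := (j * _)%N.
have [d def_d] : exists d, i = (j + d.+1)%N by exists (i - j.+1); lia.
have def_I : I = (J + d.+1 * (2 * p))%N by rewrite /I def_d mulnDl.
rewrite (@foldl_steps _ e f (e * f) (e * z) (y * f) J I) //; try lia.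
(* Spacing the markers by [2 * p] rather than [p] keeps this exponent at least [p], where powers are
   periodic. *)
- have -> : (I - J.+1 = (2 * p).-1 + d.*2 * p)%N by rewrite def_I; lia.
  by rewrite spow_periodic // ?mulgA ?ee -?mulgA ?ff //; lia.
- by move=> n lt_n; rewrite /G !marker_lt //; lia.
- by rewrite /G marker_eq marker_lt //; lia.
- by move=> n /andP[lt_n lt_nJ]; rewrite /G marker_lt // marker_gt.
- by rewrite /G marker_eq marker_gt //; lia.
by move=> n /andP[lt_n lt_nN]; rewrite /G !marker_gt //; lia.
Qed.

Lemma marker_fooling n (M : ooo_machine S n.+1) m :
  (forall w pi, output (run M (ooo_stream w pi)) = word_product w) ->
  n.+1 = (m.+1 * (2 * p)).*2 ->
  e * y * z * f <> e * y * spow g p * z * f \/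
  e * y * z * f <> e * z * spow g (2 * p).-1 * y * f ->
  m <= #|memory M|.
Proof.
have [p0 _] := idem_exponentP p_exp; move=> M_ok def_n neq.
(* Multiples start at [i.+1] so that block 0 always carries the idempotent [e]. *)
pose pos (i : 'I_m) := (i.+1 * (2 * p))%N.
pose r (i : 'I_m) (k : 'I_n.+1) := marker e f y (pos i) k./2.
pose c (i : 'I_m) (k : 'I_n.+1) := marker e f z (pos i) k./2.
pose P := [pred k : 'I_n.+1 | ~~ odd k].
have ansE i j : word_product (mix P (r i) (c j)) =
    foldl *%g e (mkseq (G (pos i) (pos j)) (m.+1 * (2 * p))).
  rewrite -foldl_interleave -def_n.
  set W := interleave _ _.
  have F0 : W 0 = e.
    by rewrite /W /interleave /= marker_lt // /pos; lia.
  rewrite -[in RHS]F0 (@word_product_mkseq _ _ W) ?F0 //.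
  rewrite /mkseq -val_enum_ord -map_comp; apply: eq_map => k /=.
  by rewrite /W /interleave; case: (odd k).
have bound i : (pos i).+1 < m.+1 * (2 * p).
  by rewrite /pos; have := ltn_ord i; nia.
apply: (fooling_set (P := P) (r := r) (c := c) M_ok) => i j lt_ij.
(* For rows [i < j], column [j] opposes the upper value to the diagonal one, and column [i] the
   diagonal value to the lower one. *)
case: neq => neq; [exists j|exists i]; rewrite !ansE markers_diag //.
  by rewrite markers_upper //; [move/esym|exact: bound].
by rewrite markers_lower //; exact: bound.
Qed.

End Markers.

Lemma middle_commutation p e f : idem_exponent S p ->
  e * e = e -> f * f = f ->
  (forall y z, e * y * z * f = e * y * spow (e * f) p * z * f) ->
  (forall y z, e * y * z * f = e * z * spow (e * f) (2 * p).-1 * y * f) ->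
  forall y z, e * y * z * f = e * z * y * f.
Proof.
move=> p_exp ee ff upper lower y z.
have [p0 pP] := idem_exponentP p_exp.
set g := e * f in upper lower; set k := (2 * p).-1 in lower.
have k0 : 0 < k by rewrite /k; lia.
have kS : k.+1 = (p + 1 * p)%N by rewrite /k; lia.
(* [lower] moves [g] to the right, where it merges into [g^(2p) = g^p]; [upper] with [z := f] erases
   that power. *)
have absorb_g x : e * g * x * f = e * x * f.
  have := lower g x; rewrite -(mulgA (e * x)) -spowSr // kS.
  rewrite spow_periodic // => ->.
  by have := upper x f; rewrite -!mulgA ff => <-.
have absorb n x : 0 < n -> e * spow g n * x * f = e * x * f.
  case: n => // n _; elim: n x => [|n IHn] x; first exact: absorb_g.
  by rewrite spowS // mulgA -(mulgA (e * g)) absorb_g mulgA IHn.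
(* [lower] brings [g^k] next to the left [e], where it is absorbed; [lower] read backwards restores
   the order of [u] and [v]. *)
have drop u v : e * u * spow g k * v * f = e * u * v * f.
  have -> : e * u * spow g k * v * f = e * u * (spow g k * v) * f.
    by rewrite !mulgA.
  rewrite lower.
  have -> : e * (spow g k * v) * spow g k * u * f =
            e * spow g k * (v * spow g k * u) * f by rewrite !mulgA.
  by rewrite absorb // !mulgA -lower.
by rewrite lower drop.
Qed.

End Interleaving.

Lemma not_middle_commutative_witness (S : finSemigroupType) p :
  idem_exponent S p -> ~ middle_commutative S ->
  exists e f y z : S, [/\ e * e = e, f * f = f &
    e * y * z * f <> e * y * spow (e * f) p * z * f \/
    e * y * z * f <> e * z * spow (e * f) (2 * p).-1 * y * f].
Proof.
move=> p_exp; apply: contra_notP => no_wit e f y z ee ff.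
apply: (middle_commutation p_exp ee ff) => {}y {}z; apply: contrapT => neq;
  by apply: no_wit; exists e, f, y, z; split=> //; first [by left|by right].
Qed.

(** * From many memory states to logarithmically many bits *)

Lemma bigOmega_frequently (R : realType) (u v : nat -> R) (c : R) : (0 < c)%R ->
  (forall N : nat, exists2 n, N <= n & (c <= u n / v n)%R) -> Defs.bigOmega u v.
Proof.
move=> c0 freq; rewrite /Defs.bigOmega limn_esup_lim.
apply: (@lt_le_trans _ _ c%:E); first by rewrite lte_fin.
(* The upper limit is the limit of the suprema over tails, and each tail contains an index with
   ratio at least [c]. *)
apply: lime_ge; first exact: is_cvg_esups.
apply: nearW => N; have [n le_Nn le_c] := freq N.
apply: (@le_trans _ _ (u n / v n)%:E); first by rewrite lee_fin.
by apply: ereal_sup_ubound; exists n.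
Qed.

(** From [n <= m ^ 2 <= 2 ^ (2 * s)] comes [ln n <= 2 * s * ln 2], and [ln 2 <= 1]. *)
Lemma ln_nat_bound (R : realType) (n m s : nat) : 1 < n ->
  n <= m ^ 2 -> m <= 2 ^ s -> (2^-1 <= s%:R / ln n%:R :> R)%R.
Proof.
move=> n1 le_nm le_ms.
have ln_n : (0 < ln n%:R :> R)%R by rewrite ln_gt0 // ltr1n.
rewrite ler_pdivlMr // mulrC ler_pdivrMr //.
have n_pos : (0 < n%:R :> R)%R by rewrite ltr0n; lia.
have le_n : n <= 2 ^ (s * 2).
  by rewrite expnM (leq_trans le_nm) // leq_sqr.
apply: (@le_trans _ _ (ln ((2 ^ (s * 2))%N%:R))).
  by rewrite ler_ln ?posrE ?ltr0n ?expn_gt0 ?ler_nat //; lia.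
rewrite natrX lnXn ?ltr0n // -[(ln _ *+ _)%R]mulr_natr natrM.
rewrite ler_piMl ?mulr_ge0 //.
by apply: (@le_ln1Dx R 1); rewrite (@lt_trans _ _ 0%R) // ltrN10.
Qed.

Lemma not_middle_commutative_log_space (R : realType) (S : finSemigroupType) :
  ~ middle_commutative S -> ooo_space_bigOmega S (fun n => ln n%:R : R)%R.
Proof.
move=> nmcS A s A_ok A_bits; have p_exp := idempotent_power_exponent S.
have [e [f [y [z [ee ff neq]]]]] := not_middle_commutative_witness p_exp nmcS.
have [p0 _] := idem_exponentP p_exp.
move: (idempotent_power S) p_exp p0 neq => p p_exp p0 neq.
apply: (@bigOmega_frequently _ _ _ 2^-1%R); first by rewrite invr_gt0.
(* [N] makes the length large, and [8 * p] gives [4 * p * (m + 1) <= m ^ 2]. Lengths of this form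
   suffice for an upper limit. *)
move=> N; pose m := (N + 8 * p)%N.
pose n := ((m.+1 * (2 * p)).*2).-1.
have def_n : n.+1 = (m.+1 * (2 * p)).*2 by rewrite /n prednK //; lia.
exists n.+1; first by rewrite def_n /m; nia.
apply: (@ln_nat_bound _ _ m); first by rewrite def_n /m; nia.
  by rewrite def_n /m -mul2n; nia.
apply: leq_trans (A_bits n).
exact: (marker_fooling p_exp ee ff (A_ok n) def_n neq).
Qed.

Local Open Scope ring_scope.

Theorem theorem4p4 (R : realType) (S : finSemigroupType) :
  (variety_join Li Com S -> ooo_space_bigO S (fun _ : nat => 1 : R)) /\
  (~ variety_join Li Com S -> ooo_space_bigOmega S (fun n : nat => ln n%:R : R)).
Proof.
split=> [/join_middle_commutative|nS].
  exact: middle_commutative_constant_space.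
by apply: not_middle_commutative_log_space => /middle_commutative_join.
Qed.
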